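(* Let $q$ be a prime power, $M=q+1$ and $N=q^2+q+1$. Let $\alpha$ be a generator of the multiplicative group of $\mathbb{F}_{q^3}$, let $\mathrm{Tr}:\mathbb{F}_{q^3}\to\mathbb{F}_q$ be $\mathrm{Tr}(\beta)=\beta+\beta^q+\beta^{q^2}$, and let $\mathcal{M}=\{t\in\mathbb{Z}_N:\mathrm{Tr}(\alpha^t)=0\}$ (the $(N,M,1)$-Singer difference set, which has $M$ elements). Let $F$ be the $M\times N$ equiangular tight frame obtained by taking the rows of the $N\times N$ discrete Fourier transform matrix indexed by $\mathcal{M}$ and normalizing the resulting columns, i.e. $F=\big(M^{-1/2}e^{-2\pi i mn/N}\big)_{m\in\mathcal{M},\,n\in\mathbb{Z}_N}$. Then for every $C\ge1$ and every $p\in[0,1]$ with $(1-p)N$ an integer and $$p\leq\frac{1}{2}-\frac{C^2}{C^4+1},$$ $F$ is a $(p,C)$-numerically erasure-robust frame.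
   Context: The condition $\mathrm{Tr}(\alpha^t)=0$ depends only on $t$ modulo $N$. An $M\times N$ frame is an $M\times N$ matrix whose columns span $\mathbb{C}^M$. For an $M\times K$ matrix $A$, $\mathrm{Cond}(A)$ is the ratio of its greatest singular value to its smallest one, i.e. $\mathrm{Cond}(A)=\sqrt{\lambda_{\max}(AA^* )/\lambda_{\min}(AA^* )}$ where $AA^*$ is $M\times M$, with $\mathrm{Cond}(A)=\infty$ if $A$ has rank less than $M$. For a subset $\mathcal{K}$ of the column index set, $F_{\mathcal{K}}$ is the submatrix of $F$ formed by the columns indexed by $\mathcal{K}$. Given $p\in[0,1]$ (with $(1-p)N$ an integer) and $C\ge1$, an $M\times N$ frame $F$ is a $(p,C)$-numerically erasure-robust frame if $\mathrm{Cond}(F_{\mathcal{K}})\le C$ for every set $\mathcal{K}$ of column indices of size $(1-p)N$. *)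

(* Defs.v *)
From HB Require Import structures.
From mathcomp Require Import all_boot all_order all_algebra.
From mathcomp Require Import all_fingroup all_solvable.
From mathcomp Require Import classical_sets constructive_ereal reals trigo.
From mathcomp Require Import complex.

Set Implicit Arguments.
Unset Strict Implicit.
Unset Printing Implicit Defensive.

Import Order.TTheory GRing.Theory Num.Theory.
Local Open Scope ring_scope.
Local Open Scope complex_scope.

Definition prime_power (q : nat) : Prop :=
  exists p k : nat, [/\ prime p, (0 < k)%N & q = (p ^ k)%N].

(* A (#|G|, k, l)-difference set: every nonzero g is a difference of exactly
   l ordered pairs of elements of D. *)
Definition difference_set (G : finZmodType) (D : {set G}) (k l : nat) : Prop :=
  #|D| = k /\
  forall g : G, g != 0 ->
    #|[set xy : G * G | [&& xy.1 \in D, xy.2 \in D & xy.1 - xy.2 == g]]| = l.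

(* The trace from F_{q^3} to F_q, when L has q^3 elements; F_q is then the
   subfield {x | x ^+ q = x} of L, so the value is kept in L. *)
Definition trace3 (L : finFieldType) (q : nat) (b : L) : L :=
  b + b ^+ q + b ^+ (q ^ 2).

(* The residues t modulo N = q^2 + q + 1 such that Tr(alpha^t) = 0, each tested
   on its representative in {0, ..., N-1}. The bound is written (...).+1 so that
   'I_N carries its structure of additive group modulo N. *)
Definition singer_set (L : finFieldType) (q : nat) (alpha : L) :
    {set 'I_(q ^ 2 + q).+1} :=
  [set t : 'I_(q ^ 2 + q).+1 | trace3 q (alpha ^+ t) == 0].

Definition expi (R : realType) (x : R) : R[i] := cos x +i* sin x.

(* Rows are indexed by 'I_#|M|, through the increasing enumeration enum_val of
   the Singer set M; the normalization is (q + 1)^(-1/2). *)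
Definition singer_frame (R : realType) (L : finFieldType) (q : nat)
    (alpha : L) : 'M[R[i]]_(#|singer_set q alpha|, (q ^ 2 + q).+1) :=
  \matrix_(j, n)
    let m : 'I_(q ^ 2 + q).+1 := enum_val j in
    ((Num.sqrt q.+1%:R)^-1)%:C *
    expi (- (2 * pi * m%:R * n%:R / (q ^ 2 + q).+1%:R)).

Definition adjoint_mx (R : realType) (M N : nat) (A : 'M[R[i]]_(M, N)) :
    'M[R[i]]_(N, M) := map_mx conjc A^T.

(* The columns of F span R[i]^M. *)
Definition is_frame (R : realType) (M N : nat) (F : 'M[R[i]]_(M, N)) : Prop :=
  row_full F^T.

Definition equiangular_tight_frame (R : realType) (M N : nat)
    (F : 'M[R[i]]_(M, N)) : Prop :=
  let gram := adjoint_mx F *m F in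
  [/\ forall n, gram n n = 1,
      exists2 a : R, 0 < a & F *m adjoint_mx F = (a%:C)%:M
    & exists c : R, forall n n', n != n' -> `|gram n n'| = c%:C].

Definition real_eigenvalues (R : realType) (M : nat) (G : 'M[R[i]]_M) : set R :=
  [set x : R | eigenvalue G x%:C]%classic.

(* A A^* is Hermitian, so all its eigenvalues are real: for M > 0 the sup and
   the inf below are its greatest and least eigenvalues. *)
Definition cond_mx (R : realType) (M K : nat) (A : 'M[R[i]]_(M, K)) : \bar R :=
  let spec := real_eigenvalues (A *m adjoint_mx A) in
  if (\rank A < M)%N then +oo%E else (Num.sqrt (sup spec / inf spec))%:E.

Definition columns (T : Type) (M N : nat) (F : 'M[T]_(M, N)) (K : {set 'I_N}) :
    'M[T]_(M, #|K|) :=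
  colsub (fun j : 'I_#|K| => enum_val j) F.

(* Meant for 0 <= p <= 1 with (1 - p) N an integer, and 1 <= C. *)
Definition numerically_erasure_robust (R : realType) (M N : nat)
    (F : 'M[R[i]]_(M, N)) (p C : R) : Prop :=
  is_frame F /\
  forall K : {set 'I_N}, #|K|%:R = (1 - p) * N%:R ->
    (cond_mx (columns F K) <= C%:E)%E.

(* Main.v *)
Require Import Defs.
From HB Require Import structures.
From mathcomp Require Import all_boot all_order all_algebra.
From mathcomp Require Import all_fingroup all_solvable all_field.
From mathcomp Require Import classical_sets constructive_ereal reals trigo.
From mathcomp Require Import complex ring lra zify.

Set Implicit Arguments.
Unset Strict Implicit.
Unset Printing Implicit Defensive.

Import Order.TTheory GRing.Theory Num.Theory.
Local Open Scope ring_scope.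

(** Write F for the frame, M = q + 1 for the number of its rows, and let K be a
    set of columns of size (1 - p) N. Because M is the size of a difference set
    and every nonzero residue d is exactly once a difference m - m' of two row
    indices, every sum over pairs of rows of a function of m - m' is a sum over
    all residues. This is [difference_set_sum], and it is used twice.

    Equiangularity: the inner product of two distinct columns is, up to the
    factor 1 / M, a character sum over the difference set; the square of its
    modulus is a sum over pairs of rows, hence the constant M - 1 since the
    character sums to zero over the whole group.

    Robustness: the entry (m, m') of G = F_K F_K^* is the value at m - m' of the
    Fourier transform of the indicator of K, divided by M. By Parseval's
    identity, tr ((G - (#|K| / M) I)^2) = #|K| (N - #|K|) / M^2, that is
    s (#|K| / M)^2 with s = p / (1 - p) ([columns_trace_sqr]). So for two
    distinct eigenvalues x and y of G, with a = #|K| / M,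
      (x - a)^2 + (a - y)^2 <= s a^2,
    and by the Cauchy-Schwarz inequality
      (x - a) + C^2 (a - y) <= sqrt ((1 + C^4) s) a.
    When (1 + C^4) s <= (C^2 - 1)^2 the right-hand side is at most (C^2 - 1) a,
    and the inequality reads x <= C^2 y ([cond_mx_le]). The hypothesis on p
    says exactly that (1 + C^4) p <= (C^2 - 1)^2 / 2, and p <= 1/2, so
    s <= 2 p satisfies this bound.

    The difference set: the trace has a kernel H with q^2 elements. Since
    alpha^N generates the multiplicative group of F_q, H minus 0 is a disjoint
    union of q + 1 classes modulo that group, one for each residue t modulo N
    with Tr (alpha^t) = 0. For every g, the map z |-> (Tr z, Tr (alpha^g z))
    from q^3 elements to q^2 elements has a nonzero zero, so g is a difference
    of two elements of the set. For g <> 0 there are q^2 + q differences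
    available to q^2 + q residues, so each of them occurs exactly once
    ([difference_set1_of_cover]). *)

(** * Difference sets *)

Lemma card_zero_difference (G : finZmodType) (D : {set G}) :
  #|[set xy : G * G | [&& xy.1 \in D, xy.2 \in D & xy.1 - xy.2 == 0]]| = #|D|.
Proof.
have diag_inj : injective (fun x : G => (x, x)) by move=> x y [].
rewrite -(card_imset (mem D) diag_inj).
apply: eq_card => -[x y]; rewrite inE /= subr_eq0; apply/and3P/imsetP => /=.
  by move=> [xD _ /eqP<-]; exists x.
by move=> [z zD [-> ->]].
Qed.

(** There are k (k - 1) pairs of distinct elements and as many nonzero
    elements of the group, so that existence of a representation forces
    uniqueness. *)
Lemma difference_set1_of_cover (G : finZmodType) (D : {set G}) (k : nat) :
  #|D| = k -> #|G| = (k * k.-1).+1 ->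
  (forall g, g != 0 -> exists2 x, x \in D & exists2 y, y \in D & x - y = g) ->
  difference_set D k 1.
Proof.
move=> cD cG cover; split=> // g g0.
pose r (h : G) :=
  #|[set xy : G * G | [&& xy.1 \in D, xy.2 \in D & xy.1 - xy.2 == h]]|.
have r_gt0 h : h != 0 -> (0 < r h)%N.
  move=> /cover[x xD [y yD xy]]; apply/card_gt0P; exists (x, y).
  by rewrite inE /= xD yD xy eqxx.
have sum_r : (\sum_h r h = k * k)%N.
  rewrite -cD -cardsX -sum1_card.
  rewrite (partition_big (fun xy : G * G => xy.1 - xy.2) predT) //=.
  apply: eq_bigr => h _; rewrite /r -sum1_card; apply: eq_bigl => xy.
  by rewrite !inE andbA.
have sum_nz : (\sum_(h : G | h != 0%R) 1 = \sum_(h : G | h != 0%R) r h)%N.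
  apply: (@addnI k); move: sum_r; rewrite (bigD1 0) //= {1}/r.
  rewrite card_zero_difference cD => ->.
  rewrite sum1_card cardC1 cG /=; case: (k) => // m.
  by rewrite [RHS]mulnS.
have [_] := leqif_sum (fun (h : G) (nz : h != 0) => leqif_eq (r_gt0 h nz)).
by rewrite sum_nz eqxx => /esym/forall_inP/(_ g g0)/eqP.
Qed.

(** A sum over pairs of elements of D becomes a sum over the whole group, where
    orthogonality of characters applies. *)
Lemma difference_set_sum (G : finZmodType) (D : {set G}) (k l : nat)
    (V : zmodType) (f : G -> V) : difference_set D k l ->
  \sum_(x in D) \sum_(y in D) f (x - y) =
    f 0 *+ k + (\sum_(d | d != 0) f d) *+ l.
Proof.
move=> [cD rD]; rewrite pair_big /=.
rewrite (partition_big (fun xy : G * G => xy.1 - xy.2) predT) //=.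
have fiber d : \sum_(xy : G * G | [&& xy.1 \in D & xy.2 \in D] &&
      (xy.1 - xy.2 == d)) f (xy.1 - xy.2) =
    f d *+ #|[set xy : G * G | [&& xy.1 \in D, xy.2 \in D & xy.1 - xy.2 == d]]|.
  rewrite -sumr_const; apply: eq_big => [xy|xy /andP[_ /eqP->]//].
  by rewrite inE andbA.
rewrite (bigD1 0) //= fiber; congr (_ + _); last first.
  by rewrite -sumrMnl; apply: eq_bigr => d d0; rewrite fiber rD.
by rewrite card_zero_difference cD.
Qed.

(** * Characters of the cyclic group *)

Section Characters.
Variable R : realType.
Implicit Types (x y : R).

Lemma expiD x y : expi (x + y) = expi x * expi y :> R[i].
Proof.
rewrite /expi cosD sinD; apply/eqP; rewrite eq_complex /= eqxx /=.
by rewrite [cos x * _ + _]addrC.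
Qed.

Lemma expiMn x n : expi (x *+ n) = expi x ^+ n :> R[i].
Proof.
elim: n => [|n IH]; first by rewrite /expi mulr0n cos0 sin0.
by rewrite mulrS expiD IH exprS.
Qed.

Lemma expi_norm x : `|expi x| = 1 :> R[i].
Proof. by rewrite normc_def /= cos2Dsin2 sqrtr1. Qed.

Variable n : nat.
Local Notation N := n.+1.

Definition dft_root : R[i] := expi (- (2 * pi / N%:R)).

Lemma dft_root_expN : dft_root ^+ N = 1.
Proof.
rewrite -expiMn mulNrn -[(_ / _) *+ _]mulr_natr divfK ?pnatr_eq0 //.
by rewrite /expi cosN sinN mulr_natl cos2pi sin2pi oppr0.
Qed.

(** If the order m of the root were less than N, the angle 2 pi m / N would be
    in ]0, 2 pi[ with cosine 1; then the sine of its half y would vanish,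
    although 0 < y < pi. *)
Lemma dft_root_prim : N.-primitive_root dft_root.
Proof.
have [m mP mN] := prim_order_exists (ltn0Sn n) dft_root_expN.
suff Nm : (N <= m)%N.
  suff <- : m = N by [].
  by apply/eqP; rewrite eqn_leq Nm dvdn_leq.
rewrite leqNgt; apply/negP => ltmN.
have m0 := prim_order_gt0 mP.
have /eqP := prim_expr_order mP.
rewrite -expiMn eq_complex /= => /andP[/eqP c1 _].
pose y : R := pi * m%:R / N%:R.
have yE : - (2 * pi / N%:R) *+ m = - (y *+ 2).
  rewrite /y mulNrn; congr (- _); rewrite -[_ *+ m]mulr_natr.
  by rewrite -[_ *+ 2]mulr_natr; ring.
have y0 : 0 < y by rewrite /y divr_gt0 ?mulr_gt0 ?pi_gt0 ?ltr0n.
have ypi : y < pi.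
  by rewrite /y ltr_pdivrMr ?ltr0n // ltr_pM2l ?pi_gt0 // ltr_nat.
have := sin_gt0_pi (x := y); rewrite y0 ypi => /(_ isT) s0.
move: c1; rewrite yE cosN mulr2n cosD -!expr2.
have := cos2Dsin2 y => h1 h2.
have : sin y ^+ 2 = 0 by lra.
by move/eqP; rewrite sqrf_eq0 gt_eqF.
Qed.

Implicit Types a b c : 'I_N.

(** The additive characters of Z/N: the second argument selects the character,
    and the roles of the two arguments are symmetric. *)
Definition dft_char a b : R[i] := dft_root ^+ (a * b).

Lemma dft_entry a b :
  expi (- (2 * pi * a%:R * b%:R / N%:R)) = dft_char a b :> R[i].
Proof.
rewrite /dft_char -expiMn mulNrn; congr (expi (- _)).
rewrite -[RHS]mulr_natr natrM; ring.
Qed.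

Lemma dft_charC a b : dft_char a b = dft_char b a.
Proof. by rewrite /dft_char mulnC. Qed.

Lemma dft_charD a b c : dft_char (a + b) c = dft_char a c * dft_char b c.
Proof.
rewrite /dft_char -exprD -mulnDl; apply/eqP.
by rewrite (eq_prim_root_expr dft_root_prim) /= modnMml.
Qed.

Lemma dft_char0 c : dft_char 0 c = 1. Proof. by rewrite /dft_char mul0n. Qed.

Lemma dft_char_norm a b : `|dft_char a b| = 1.
Proof. by rewrite normrX expi_norm expr1n. Qed.

(** Both sides are inverse to the character value, which has modulus 1. *)
Lemma dft_charN a b : dft_char (- a) b = (dft_char a b)^*%C.
Proof.
have nz : dft_char a b != 0 by rewrite -normr_eq0 dft_char_norm oner_eq0.
apply: (mulfI nz); rewrite -dft_charD subrr dft_char0 -sqr_normc.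
by rewrite dft_char_norm expr1n.
Qed.

Lemma dft_charB a b c :
  dft_char (a - b) c = dft_char a c * (dft_char b c)^*%C.
Proof. by rewrite dft_charD dft_charN. Qed.

Lemma dft_char_sum a : \sum_b dft_char a b = if a == 0 then N%:R else 0.
Proof.
have [->|a0] := eqVneq.
  under eq_bigr do rewrite dft_char0.
  by rewrite sumr_const card_ord.
have z1 : dft_root ^+ a - 1 != 0.
  rewrite subr_eq0 -(expr0 dft_root) (eq_prim_root_expr dft_root_prim).
  by rewrite mod0n modn_small.
apply: (mulfI z1); rewrite mulr0.
under eq_bigr do rewrite /dft_char exprM.
by rewrite -subrX1 -exprM mulnC exprM dft_root_expN expr1n subrr.
Qed.

End Characters.

(** * Eigenvalues and condition numbers *)

Section Spectral.
Variables (C : numClosedFieldType) (n : nat) (H : 'M[C]_n).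
Hypothesis hermH : H \is hermsymmx.

Lemma eigenvalue_spectral_diag x :
  eigenvalue H x -> exists i, x = spectral_diag H 0 i.
Proof.
have HE := orthomx_spectralP (hermitian_normalmx hermH).
have Pu := spectral_unit H.
move=> /eigenvalueP[v vH v0].
pose u := v *m invmx (spectralmx H).
have u0 : u != 0.
  apply: contraNneq v0 => u0.
  by rewrite -(mulmxKV Pu v) -/u u0 mul0mx.
have uD : u *m diag_mx (spectral_diag H) = x *: u.
  rewrite /u scalemxAl -vH {3}HE !mulmxA -[_ *m _ *m invmx _]mulmxA.
  by rewrite mulmxV // mulmx1.
have /rV0Pn[i ui] := u0.
exists i; apply: (mulIf ui).
by have /rowP/(_ i) := uD; rewrite mul_mx_diag !mxE mulrC.
Qed.

(** For a Hermitian matrix this trace is the squared Frobenius norm, so this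
    formula and the next lemmas bound how far eigenvalues are from 0. *)
Lemma trace_sqr_spectral : \tr (H *m H) = \sum_i spectral_diag H 0 i ^+ 2.
Proof.
have HE := orthomx_spectralP (hermitian_normalmx hermH).
have Pu := spectral_unit H.
rewrite {1 2}HE mxtrace_mulC !mulmxA -[_ *m _ *m invmx _]mulmxA mulmxV //.
rewrite mulmx1 mxtrace_mulC !mulmxA mulmxV // mul1mx mulmx_diag mxtrace_diag.
by apply: eq_bigr => i _; rewrite !mxE.
Qed.

Lemma spectral_diag_sqr_ge0 i : 0 <= spectral_diag H 0 i ^+ 2.
Proof.
rewrite real_exprn_even_ge0 //.
by have /mxOverP := hermitian_spectral_diag_real hermH.
Qed.

Lemma eigenvalue_sqr_le_trace x : eigenvalue H x -> x ^+ 2 <= \tr (H *m H).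
Proof.
move=> /eigenvalue_spectral_diag[i ->].
rewrite trace_sqr_spectral (bigD1 i) //=.
by rewrite lerDl sumr_ge0 // => j _; apply: spectral_diag_sqr_ge0.
Qed.

(** Distinct eigenvalues occupy distinct places of the spectral diagonal, and
    the other terms of the sum of squares are nonnegative. *)
Lemma eigenvalues_sqrD_le_trace x y : x != y ->
  eigenvalue H x -> eigenvalue H y -> x ^+ 2 + y ^+ 2 <= \tr (H *m H).
Proof.
move=> xy /eigenvalue_spectral_diag[i xi] /eigenvalue_spectral_diag[j yj].
have ij : j != i by apply: contraNneq xy => ji; rewrite xi yj ji.
rewrite trace_sqr_spectral (bigD1 i) //= (bigD1 j) //= xi yj addrA.
by rewrite lerDl sumr_ge0 // => h _; apply: spectral_diag_sqr_ge0.
Qed.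

End Spectral.

Lemma eigenvalue_shift (F : fieldType) (n : nat) (B : 'M[F]_n) (a x : F) :
  eigenvalue B x -> eigenvalue (B - a%:M) (x - a).
Proof.
move=> /eigenvalueP[v vB v0]; apply/eigenvalueP; exists v => //.
by rewrite mulmxBr vB mul_mx_scalar scalerBl.
Qed.

Section Conditioning.
Variables (R : realType) (M K : nat) (A : 'M[R[i]]_(M, K)).
Local Notation G := (A *m adjoint_mx A).

Lemma gram_shift_herm (a : R) : G - (a%:C)%C%:M \is hermsymmx.
Proof.
apply/is_hermitianmxP; rewrite expr0 scale1r; apply/matrixP => i j.
rewrite !mxE rmorphB rmorph_sum /= rmorphMn /=; congr (_ - _).
  apply: eq_bigr => h _; rewrite !mxE mulrC.
  by rewrite rmorphM /= -[Num.conj _]/(conjc _)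
             -[X in _ = _ * X]/(conjc _) conjcK.
by rewrite -[Num.conj _]/(conjc _) conjc_real eq_sym.
Qed.

Variables (a s C : R).
Hypotheses (a0 : 0 < a) (C1 : 1 <= C).
Hypothesis traceG :
  \tr ((G - (a%:C)%C%:M) *m (G - (a%:C)%C%:M)) <= ((s * a ^+ 2)%:C)%C.
Hypothesis sC : (C ^+ 4 + 1) * s <= (C ^+ 2 - 1) ^+ 2.

(** The condition on C and s forces s < 1, so that no eigenvalue is as far as a
    from a. *)
Lemma real_eigenvalue_gt0 x : real_eigenvalues G x -> 0 < x.
Proof.
rewrite /real_eigenvalues /= => /(eigenvalue_shift (a%:C)%C).
move=> /(eigenvalue_sqr_le_trace (gram_shift_herm a))/le_trans/(_ traceG).
rewrite -rmorphB -rmorphXn /= lecR => h.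
have s1 : s < 1.
  have C2 : 1 <= C ^+ 2 by rewrite exprn_ege1.
  have C4 : C ^+ 4 = C ^+ 2 * C ^+ 2 by rewrite -exprD.
  rewrite -(@ltr_pM2l _ (C ^+ 4 + 1)); last by rewrite C4; nra.
  by apply: le_lt_trans sC _; rewrite C4 mulr1; nra.
rewrite ltNge; apply/negP => x0.
have : s * a ^+ 2 < a ^+ 2 by rewrite gtr_pMl // exprn_gt0.
have ax : a * x <= 0 by rewrite pmulr_rle0.
by have := sqr_ge0 x; nra.
Qed.

(** The Cauchy-Schwarz inequality applied to the vectors (1, C^2) and
    (x - a, a - y). *)
Lemma real_eigenvalues_ratio x y :
  real_eigenvalues G x -> real_eigenvalues G y -> x <= C ^+ 2 * y.
Proof.
move=> ex ey; have x0 := real_eigenvalue_gt0 ex.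
have y0 := real_eigenvalue_gt0 ey.
have C2 : 1 <= C ^+ 2 by rewrite exprn_ege1.
have [<-|xy] := eqVneq x y; first by rewrite ler_peMl // ltW.
move: ex ey; rewrite /real_eigenvalues /=.
move=> /(eigenvalue_shift (a%:C)%C) ex /(eigenvalue_shift (a%:C)%C) ey.
have := eigenvalues_sqrD_le_trace (gram_shift_herm a) _ ex ey.
rewrite (inj_eq (addIr _)) (inj_eq (@complexI _)).
move=> /(_ xy)/le_trans/(_ traceG).
rewrite -!rmorphB -!rmorphXn -rmorphD /= lecR => h.
have C4 : C ^+ 4 = C ^+ 2 * C ^+ 2 by rewrite -exprD.
move: C2 sC; rewrite C4; set c := C ^+ 2 => c1 sc.
pose u := x - a; pose v := a - y.
have cs : (u + c * v) ^+ 2 <= ((c - 1) * a) ^+ 2.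
  have h1 : (u + c * v) ^+ 2 <= (c * c + 1) * (u ^+ 2 + v ^+ 2).
    rewrite -subr_ge0.
    have -> : (c * c + 1) * (u ^+ 2 + v ^+ 2) - (u + c * v) ^+ 2 =
      (c * u - v) ^+ 2 by ring.
    exact: sqr_ge0.
  apply: le_trans h1 _.
  apply: le_trans (_ : (c * c + 1) * (s * a ^+ 2) <= _).
    rewrite ler_pM2l; last by nra.
    by rewrite [v ^+ 2](_ : _ = (y - a) ^+ 2) //; rewrite /v; ring.
  by rewrite exprMn mulrA ler_pM2r // exprn_gt0.
have : u + c * v <= (c - 1) * a.
  rewrite -(ger0_norm (x := (c - 1) * a)); last first.
    by rewrite mulr_ge0 ?subr_ge0 // ltW.
  apply: le_trans (ler_norm _) _.
  by rewrite -(@ler_pXn2r _ 2) ?nnegrE // !real_normK ?num_real.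
by rewrite /u /v; lra.
Qed.

(** The pairwise bound on eigenvalues passes to the supremum and the infimum of
    the spectrum; the rank is full because 0 is not an eigenvalue. *)
Lemma cond_mx_le : (cond_mx A <= C%:E)%E.
Proof.
have rankA : \rank A = M.
  apply/eqP; rewrite eqn_leq rank_leq_row /= leqNgt; apply/negP => rA.
  suff /real_eigenvalue_gt0 : real_eigenvalues G 0 by rewrite ltxx.
  rewrite /real_eigenvalues /=.
  have /eqP/rowV0Pn[v /sub_kermxP vA v0] : kermx A <> 0.
    by move/eqP; rewrite kermx_eq0 -row_leq_rank leqNgt rA.
  by apply/eigenvalueP; exists v; rewrite // mulmxA vA mul0mx scale0r.
rewrite /cond_mx rankA ltnn lee_fin; set S := real_eigenvalues _.
have C0 : 0 < C by apply: lt_le_trans C1.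
have C20 : 0 < C ^+ 2 by rewrite exprn_gt0.
(* The supremum of the empty set is 0, which settles an empty spectrum. *)
have [->|/set0P S0] := eqVneq S set0.
  by rewrite sup0 mul0r sqrtr0 ltW.
have supS y : S y -> sup S / C ^+ 2 <= y.
  move=> Sy; rewrite ler_pdivrMr // [y * _]mulrC; apply: (ge_sup S0) => x Sx.
  exact: (real_eigenvalues_ratio Sx Sy).
have [x Sx] := S0.
have infS : sup S / C ^+ 2 <= inf S by apply: lb_le_inf.
have xC z : S z -> x / C ^+ 2 <= z.
  by move=> Sz; rewrite ler_pdivrMr // [z * _]mulrC
                         (real_eigenvalues_ratio Sx Sz).
have infS0 : 0 < inf S.
  apply: lt_le_trans (lb_le_inf S0 xC).
  by rewrite divr_gt0 // (real_eigenvalue_gt0 Sx).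
rewrite -[leRHS]gtr0_norm // -sqrtr_sqr ler_sqrt ?exprn_ge0 //; last exact: ltW.
by rewrite ler_pdivrMr // mulrC -ler_pdivrMr.
Qed.

End Conditioning.

(** * Harmonic frames *)

Section HarmonicFrame.
Variables (R : realType) (n : nat) (D : {set 'I_n.+1}).
Local Notation N := n.+1.
Local Notation chi := (@dft_char R n).
Implicit Types (c d : 'I_N) (K : {set 'I_N}).

(** The frame cut out by an arbitrary set of rows of the Fourier matrix: the
    Singer set enters only through its being a difference set. *)
Definition harmonic_frame : 'M[R[i]]_(#|D|, N) :=
  \matrix_(j, c) ((Num.sqrt #|D|%:R)^-1%:C * chi (enum_val j) c)%C.

Local Notation F := harmonic_frame.

Lemma harmonic_frame_mul_conj i j c d :
  F i c * (F j d)^*%C =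
    #|D|%:R^-1 * (chi (enum_val i) c * (chi (enum_val j) d)^*%C).
Proof.
have conjM (r : R) (z : R[i]) : (r%:C * z)^*%C = (r%:C * z^*)%C.
  by rewrite rmorphM; congr (_ * _); apply: conjc_real.
rewrite !mxE conjM mulrACA; congr (_ * _).
rewrite -rmorphM -invfM -expr2 sqr_sqrtr ?ler0n //.
by rewrite fmorphV rmorph_nat.
Qed.

Lemma harmonic_gram c d :
  (adjoint_mx F *m F) c d = #|D|%:R^-1 * \sum_(m in D) chi m (d - c).
Proof.
rewrite !mxE [in RHS]big_enum_val mulr_sumr; apply: eq_bigr => j _.
rewrite mxE [F^T _ _]mxE mulrC harmonic_frame_mul_conj; congr (_ * _).
by rewrite ![chi (enum_val j) _]dft_charC -dft_charB.
Qed.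

Lemma columns_mul_adjoint K i j :
  (columns F K *m adjoint_mx (columns F K)) i j =
    #|D|%:R^-1 * \sum_(c in K) chi (enum_val i - enum_val j) c.
Proof.
rewrite !mxE [in RHS]big_enum_val mulr_sumr; apply: eq_bigr => h _.
rewrite [colsub _ _ _ _]mxE [adjoint_mx _ _ _]mxE [_^T _ _]mxE.
rewrite [colsub _ _ _ _]mxE.
by rewrite harmonic_frame_mul_conj dft_charB.
Qed.

Lemma harmonic_frame_tight :
  F *m adjoint_mx F = ((N%:R / #|D|%:R)%:C)%C%:M.
Proof.
apply/matrixP => i j; rewrite !mxE.
under eq_bigr => c _.
  rewrite [adjoint_mx _ _ _]mxE [_^T _ _]mxE harmonic_frame_mul_conj -dft_charB.
over.
rewrite -mulr_sumr dft_char_sum subr_eq0 (inj_eq enum_val_inj).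
case: eqP => _; last by rewrite mulr0.
by rewrite mulr1n rmorphM fmorphV !rmorph_nat mulrC.
Qed.

(** Parseval's identity for the indicator function of K, by orthogonality of
    characters. The product is the squared modulus of the Fourier coefficient
    at d; it is written with - d in place of a conjugate because the product of
    the entries (i, j) and (j, i) of a Gram matrix has this form. *)
Lemma dft_parseval K :
  \sum_d (\sum_(c in K) chi d c) * (\sum_(c in K) chi (- d) c) =
    (N * #|K|)%:R.
Proof.
transitivity (\sum_(x in K) \sum_(y in K) \sum_d chi (x - y) d).
  under eq_bigr do rewrite big_distrlr /=.
  rewrite exchange_big; apply: eq_bigr => x _ /=.
  rewrite exchange_big; apply: eq_bigr => y _ /=; apply: eq_bigr => d _.
  by rewrite dft_charB dft_charN ![chi d _]dft_charC.
under eq_bigr => x xK.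
  under eq_bigr do rewrite dft_char_sum subr_eq0 eq_sym.
  rewrite -big_mkcondr (big_pred1 x); last first.
    by move=> y /=; case: eqP => [->|]; rewrite ?xK ?andbF.
over.
by rewrite sumr_const natrM mulr_natr.
Qed.

Variables k l : nat.
Hypotheses (hD : difference_set D k l) (k0 : (0 < k)%N).

Let kC : k%:R != 0 :> R[i]. Proof. by rewrite pnatr_eq0 -lt0n. Qed.
Let kR : k%:R != 0 :> R. Proof. by rewrite pnatr_eq0 -lt0n. Qed.
Let cardD : #|D| = k. Proof. by case: hD. Qed.

(** The squared modulus is a sum over pairs of elements of D, thus
    k + l (0 - 1): the character at c <> 0 sums to zero over the group and is 1
    at 0. *)
Lemma difference_set_char_sum c : c != 0 ->
  `|\sum_(m in D) chi m c| ^+ 2 = k%:R - l%:R.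
Proof.
move=> c0; rewrite sqr_normc rmorph_sum big_distrlr /=.
under eq_bigr do under eq_bigr do rewrite -dft_charB.
rewrite (difference_set_sum (fun d => chi d c) hD) dft_char0.
have := dft_char_sum R c; rewrite (negbTE c0) (bigD1 0) //= dft_charC dft_char0.
under eq_bigr do rewrite dft_charC.
move=> /(canRL (addKr _)) ->; rewrite addr0 mulNrn; ring.
Qed.

Lemma harmonic_frame_etf : equiangular_tight_frame F.
Proof.
split.
- move=> c; rewrite harmonic_gram subrr.
  under eq_bigr do rewrite dft_charC dft_char0.
  by rewrite sumr_const cardD mulVf.
- exists (N%:R / #|D|%:R); last exact: harmonic_frame_tight.
  by rewrite divr_gt0 ?ltr0n ?cardD.
- exists (k%:R^-1 * Num.sqrt (k%:R - l%:R)) => c d cd.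
  have dc0 : d - c != 0 by rewrite subr_eq0 eq_sym.
  rewrite harmonic_gram normrM cardD rmorphM; congr (_ * _).
    by rewrite normfV normr_nat fmorphV rmorph_nat.
  have := difference_set_char_sum dc0; case: (\sum_(m in D) _) => x y.
  rewrite normc_def -rmorphXn sqr_sqrtr ?addr_ge0 ?sqr_ge0 // => h.
  congr (Num.sqrt _)%:C%C; apply: (@complexI R).
  by rewrite h rmorphB !rmorph_nat.
Qed.

Lemma harmonic_frame_is_frame : is_frame F.
Proof.
rewrite /is_frame /row_full mxrank_tr eqn_leq rank_leq_row /=.
apply: leq_trans (mxrankM_maxl F (adjoint_mx F)).
rewrite harmonic_frame_tight -scalemx1 mxrank_scale_nz ?mxrank1 // fmorph_eq0.
by rewrite mulf_neq0 ?invr_eq0 ?pnatr_eq0 ?cardD -?lt0n.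
Qed.

(** Expanding the square, tr G = #|K| comes from the diagonal, and tr (G^2) is
    a sum over pairs of rows, hence given by Parseval's identity once the term
    d = 0 is set apart. *)
Lemma columns_trace_sqr K :
  let H := columns F K *m adjoint_mx (columns F K) -
             ((#|K|%:R / k%:R)%:C)%C%:M in
  \tr (H *m H) = ((l%:R * #|K|%:R * (N%:R - #|K|%:R) / k%:R ^+ 2)%:C)%C.
Proof.
cbv zeta; set G := columns F K *m _; set a : R[i] := (_ / k%:R)%:C%C.
set H := G - a%:M.
have aE : a = #|K|%:R / k%:R by rewrite /a rmorphM fmorphV !rmorph_nat.
have GE i j : G i j = k%:R^-1 * \sum_(c in K) chi (enum_val i - enum_val j) c.
  by rewrite /G columns_mul_adjoint cardD.
have trG : \tr G = #|K|%:R.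
  rewrite /mxtrace; under eq_bigr => i _.
    rewrite GE subrr; under eq_bigr do rewrite dft_char0.
    rewrite sumr_const.
  over.
  by rewrite sumr_const card_ord cardD -[LHS]mulr_natr mulrAC mulVf ?mul1r.
pose f d := (\sum_(c in K) chi d c) * (\sum_(c in K) chi (- d) c).
have trGG : \tr (G *m G) = k%:R ^- 2 *
    ((k * #|K| ^ 2)%:R + l%:R * ((N * #|K|)%:R - (#|K| ^ 2)%:R)).
  transitivity (k%:R ^- 2 * \sum_(x in D) \sum_(y in D) f (x - y)).
    rewrite [in RHS]big_enum_val mulr_sumr; apply: eq_bigr => i _.
    rewrite mxE [in RHS]big_enum_val mulr_sumr; apply: eq_bigr => j _.
    by rewrite !GE mulrACA -invfM -expr2 /f opprB.
  rewrite (difference_set_sum f hD).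
  have f0 : f 0 = (#|K| ^ 2)%:R.
    rewrite /f oppr0; under eq_bigr do rewrite dft_char0.
    by rewrite sumr_const natrX.
  have := dft_parseval K; rewrite (bigD1 0) //= -/(f 0) f0.
  move=> /(canRL (addKr _)) ->; rewrite -[_ *+ k]mulr_natr -[_ *+ l]mulr_natr.
  by congr (_ * _); rewrite !natrM; ring.
have -> : \tr (H *m H) = \tr (G *m G) - 2 * a * \tr G + a ^+ 2 * #|D|%:R.
  rewrite /H mulmxBl !mulmxBr mul_scalar_mx mul_mx_scalar mul_scalar_mx.
  rewrite !raddfB /= !mxtraceZ mxtrace_scalar -[a *+ _]mulr_natr; ring.
rewrite trGG trG aE cardD.
rewrite [in RHS]rmorphM [in RHS]fmorphV [in RHS]rmorphXn ![in RHS]rmorphM.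
rewrite [in RHS]rmorphB ![in RHS]rmorph_nat.
by rewrite !natrM; field.
Qed.

(** The hypothesis is (C^4 + 1) s <= (C^2 - 1)^2 for s = l (N - #|K|) / #|K|,
    the squared Frobenius deviation of the Gram matrix relative to its mean
    eigenvalue #|K| / k. *)
Lemma harmonic_frame_columns_cond K (C : R) : 1 <= C -> (0 < #|K|)%N ->
  (C ^+ 4 + 1) * (l%:R * (N%:R - #|K|%:R)) <= (C ^+ 2 - 1) ^+ 2 * #|K|%:R ->
  (cond_mx (columns F K) <= C%:E)%E.
Proof.
move=> C1 K0 hC; have K0R : 0 < #|K|%:R :> R by rewrite ltr0n.
have k0R : 0 < k%:R :> R by rewrite ltr0n.
apply: (@cond_mx_le _ _ _ _ (#|K|%:R / k%:R)
  (l%:R * (N%:R - #|K|%:R) / #|K|%:R)) => //.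
- exact: divr_gt0.
- rewrite columns_trace_sqr lecR le_eqVlt; apply/orP; left; apply/eqP.
  by field; rewrite kR lt0r_neq0.
- by rewrite mulrA ler_pdivrMr.
Qed.

End HarmonicFrame.

(** * The Singer difference set *)

(** The counting half of the rank theorem. Only the consequence of additivity
    that bounds a fibre is assumed, so that f may take values in a bare finite
    type such as a product. *)
Lemma card_le_image_kernel (U : finZmodType) (T : finType) (f : U -> T)
    (B : {set T}) (K : {set U}) :
  (forall x, f x \in B) -> (forall x y, f x = f y -> x - y \in K) ->
  (#|U| <= #|B| * #|K|)%N.
Proof.
move=> fB fK; rewrite -[leqLHS]sum1_card (partition_big f (mem B)) //=.
rewrite -sum_nat_const; apply: leq_sum => b _; rewrite sum1_card.
have [x0 /eqP fx0|fib0] := pickP [pred x | f x == b]; last first.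
  by rewrite eq_card0.
rewrite -[leqLHS](card_imset _ (addIr (- x0))).
apply: subset_leq_card; apply/fintype.subsetP => y.
by move=> /imsetP[x /eqP fx ->]; apply: fK; rewrite fx fx0.
Qed.

Lemma card_roots_lt_size (F : finFieldType) (P : {poly F}) (A : {set F}) :
  P != 0 -> (forall x, x \in A -> root P x) -> (#|A| < size P)%N.
Proof.
move=> P0 rA; rewrite cardE; apply: max_poly_roots => //; last exact: enum_uniq.
by apply/allP => x; rewrite mem_enum => /rA.
Qed.

Section Singer.
Variables (L : finFieldType) (q : nat).
Hypotheses (hq : prime_power q) (hL : #|L| = (q ^ 3)%N).
Implicit Types x y c : L.
Local Notation Tr := (@trace3 L q).
Local Notation N := (q ^ 2 + q).+1.

Let q_gt1 : (1 < q)%N.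
Proof.
by case: hq => p [e [pp e0 ->]]; rewrite -(exp1n e) ltn_exp2r // prime_gt1.
Qed.

Lemma expf_qD x y : (x + y) ^+ q = x ^+ q + y ^+ q.
Proof.
case: hq => p [e [pp e0 qE]]; apply: exprDn_pchar.
have pL : p \in [pchar L].
  by apply: (@card_finPcharP _ p (e * 3)) => //; rewrite hL qE expnM.
by rewrite qE pnatX pnatE // pL.
Qed.

Lemma trace3D x y : Tr (x + y) = Tr x + Tr y.
Proof. by rewrite /trace3 -mulnn !exprM !expf_qD; ring. Qed.

Lemma trace3M c x : c ^+ q = c -> Tr (c * x) = c * Tr x.
Proof.
by move=> cq; rewrite /trace3 -mulnn !exprM !exprMn !cq; ring.
Qed.

Lemma trace3B x y : Tr (x - y) = Tr x - Tr y.
Proof. by apply/eqP; rewrite eq_sym subr_eq -trace3D subrK. Qed.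

Lemma trace3_fixed x : Tr x ^+ q = Tr x.
Proof.
rewrite /trace3 !expf_qD -!exprM mulnn -expnSr -hL expf_card.
by rewrite addrC addrA.
Qed.

(** F_q inside L, where the trace takes its values. *)
Definition ground : {set L} := [set x | x ^+ q == x].
Definition trace_ker : {set L} := [set x | Tr x == 0].

Lemma card_ground_le : (#|ground| <= q)%N.
Proof.
have sP : size ('X^q - 'X : {poly L}) = q.+1.
  by rewrite size_polyDl size_polyXn // size_polyN size_polyX ltnS.
rewrite -ltnS -sP; apply: card_roots_lt_size.
  by rewrite -size_poly_gt0 sP.
by move=> x; rewrite inE rootE !hornerE subr_eq0.
Qed.

(** The upper bound counts the roots of a polynomial of degree q^2; the lower
    bound holds because the trace takes at most q values. *)
Lemma card_trace_ker : #|trace_ker| = (q ^ 2)%N.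
Proof.
apply/eqP; rewrite eqn_leq; apply/andP; split.
  have sP : size ('X^(q ^ 2) + ('X^q + 'X) : {poly L}) = (q ^ 2).+1.
    have s1 : size ('X^q + 'X : {poly L}) = q.+1.
      by rewrite size_polyDl size_polyXn // size_polyX ltnS.
    by rewrite size_polyDl size_polyXn // s1 ltnS -{1}(expn1 q) ltn_exp2l.
  rewrite -ltnS -sP; apply: card_roots_lt_size.
    by rewrite -size_poly_gt0 sP.
  move=> x; rewrite inE rootE !(hornerD, hornerXn, hornerX) => /eqP <-.
  by rewrite /trace3 addrC [_ + x]addrC.
rewrite -(@leq_pmul2l q) ?(ltnW q_gt1) // -expnS -hL.
apply: leq_trans (_ : #|ground| * #|trace_ker| <= _)%N; last first.
  by rewrite leq_mul2r card_ground_le orbT.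
apply: (@card_le_image_kernel _ _ Tr) => [x|x y xy].
  by rewrite inE trace3_fixed.
by rewrite inE trace3B xy subrr.
Qed.

(** The two traces together take at most q^2 values on q^3 elements. *)
Lemma trace3_common_zero c : exists2 z, z != 0 & Tr z = 0 /\ Tr (c * z) = 0.
Proof.
pose K := [set z | (Tr z == 0) && (Tr (c * z) == 0)].
have [z /setD1P[z0]|K0] := pickP (mem (K :\ 0)).
  by rewrite inE => /andP[/eqP h1 /eqP h2]; exists z.
have : (#|L| <= #|finset.setX ground ground| * #|K|)%N.
  apply: (@card_le_image_kernel _ _ (fun z => (Tr z, Tr (c * z)))).
    by move=> x; rewrite !inE !trace3_fixed !eqxx.
  by move=> x y [h1 h2]; rewrite inE mulrBr !trace3B h1 h2 !subrr eqxx.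
rewrite cardsX (cardsD1 0 K) (eq_card0 K0) addn0 hL => h.
have : (q ^ 3 <= q ^ 2)%N.
  apply: leq_trans h _; rewrite -mulnn -[leqRHS]muln1.
  by rewrite !leq_mul ?card_ground_le ?leq_b1.
by rewrite leq_exp2l.
Qed.

Variable alpha : {unit L}.
Hypothesis halpha : generator [set: {unit L}]%g alpha.
Local Notation a := (val alpha).
Local Notation D := (singer_set q a).

Lemma card_units_factor : (q ^ 3).-1 = (q.-1 * N)%N.
Proof.
case: q q_gt1 => // m _; apply/eq_add_S.
by rewrite prednK ?expn_gt0 //= !expnS expn0; nia.
Qed.

Lemma order_alpha : #[alpha]%g = (q.-1 * N)%N.
Proof.
rewrite orderE; move: halpha; rewrite /generator => /eqP <-.
by rewrite card_finField_unit hL card_units_factor.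
Qed.

Lemma alpha_expr_eq i j : (a ^+ i == a ^+ j) = (i == j %[mod q.-1 * N]).
Proof.
rewrite -order_alpha -eq_expg_mod_order -!FinRing.val_unitX.
by rewrite (inj_eq val_inj).
Qed.

Lemma alpha_expr_surj x : x != 0 -> exists s, x = a ^+ s.
Proof.
rewrite -unitfE => Ux; pose u := FinRing.unit L Ux.
have : u \in <[alpha]>%g by move: halpha => /eqP <-; rewrite inE.
by move=> /cycleP[s us]; exists s; rewrite -FinRing.val_unitX -us.
Qed.

Lemma alpha_neq0 : a != 0.
Proof. by rewrite -unitfE; apply: valP. Qed.

(** The order of alpha is (q - 1) N, so alpha^N is killed by q - 1: scaling by
    it commutes with the trace, which makes the vanishing of Tr (alpha^t)
    periodic in t with period N. *)
Lemma alphaN_ground : (a ^+ N) ^+ q = a ^+ N.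
Proof.
apply/eqP; rewrite -exprM alpha_expr_eq.
have -> : (N * q = q.-1 * N + N)%N.
  by rewrite [RHS]addnC -mulSn prednK ?(ltnW q_gt1) // mulnC.
by rewrite modnDl.
Qed.

Lemma trace3_alpha_modn s : (Tr (a ^+ (s %% N)) == 0) = (Tr (a ^+ s) == 0).
Proof.
rewrite [in RHS](divn_eq s N) exprD [(s %/ N * N)%N]mulnC exprM.
rewrite trace3M; last first.
  by rewrite [LHS]exprAC alphaN_ground.
by rewrite mulf_eq0 !expf_eq0 (negbTE alpha_neq0) !andbF.
Qed.

Lemma mem_singer_set s : (inZp s \in D) = (Tr (a ^+ s) == 0).
Proof. by rewrite inE /= trace3_alpha_modn. Qed.

(** Every exponent below the order (q - 1) N of alpha is j N + t with j < q - 1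
    and t < N, and only t matters for the vanishing of the trace. Hence the
    q^2 - 1 nonzero elements of the kernel are counted by pairs (j, t) with t in
    the Singer set. *)
Lemma card_singer_set : #|D| = q.+1.
Proof.
pose phi (jt : 'I_q.-1 * 'I_N) := a ^+ (jt.1 * N + jt.2).
have phi_inj : injective phi.
  move=> [j t] [j' t'] /eqP; rewrite /phi alpha_expr_eq /=.
  have lt (i : 'I_q.-1) (u : 'I_N) : (i * N + u < q.-1 * N)%N.
    have := ltn_ord i; have := ltn_ord u; move: (nat_of_ord u) (nat_of_ord i).
    by move: (N) (q.-1) => *; nia.
  rewrite !modn_small // => /eqP h; congr (_, _); apply: val_inj => /=.
    by have /(congr1 (divn^~ N)) := h; rewrite !divnMDl // !divn_small ?addn0.
  by have /(congr1 (modn^~ N)) := h; rewrite !modnMDl !modn_small.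
have : #|finset.setX [set: 'I_q.-1] D| = #|trace_ker :\ 0|.
  rewrite -(card_imset _ phi_inj); apply: eq_card => x.
  apply/imsetP/setD1P => [[[j t]]|[x0 xK]].
    rewrite !inE /= => tD ->; rewrite expf_eq0 (negbTE alpha_neq0) andbF.
    split=> //.
    by rewrite /phi -trace3_alpha_modn modnMDl modn_small.
  have [s xs] := alpha_expr_surj x0.
  have jP : ((s %% (q.-1 * N)) %/ N < q.-1)%N.
    by rewrite ltn_divLR // ltn_mod muln_gt0 -subn1 subn_gt0 q_gt1.
  exists (Ordinal jP, inZp s).
    rewrite finset.in_setX finset.in_setT mem_singer_set -xs.
    by move: xK; rewrite inE.
  apply/eqP; rewrite xs /phi alpha_expr_eq /=.
  have <- : (s %% (q.-1 * N) %% N = s %% N)%N.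
    by rewrite modn_dvdm // dvdn_mull.
  by rewrite -divn_eq modn_mod.
rewrite cardsX cardsT card_ord => card_mul.
have Tr0 : Tr 0 = 0 by rewrite -(subrr 0) trace3B !subrr.
have q1_gt0 : (0 < q.-1)%N by rewrite -subn1 subn_gt0.
have := cardsD1 0 trace_ker; rewrite card_trace_ker inE Tr0 eqxx -card_mul.
move=> kerE; apply/eqP; rewrite -(eqn_pmul2l q1_gt0); apply/eqP.
apply: (@addnI 1); rewrite -[LHS]kerE.
by case: (q) q_gt1 => // m _; rewrite /=; nia.
Qed.

(** A nonzero common zero z = alpha^s of Tr and of z |-> Tr (alpha^g z) gives
    the elements g + s and s of the set, with difference g. *)
Lemma singer_difference_set : difference_set D q.+1 1.
Proof.
apply: difference_set1_of_cover; first exact: card_singer_set.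
  by rewrite card_ord; nia.
move=> g g0; have [z z0 [Tz Tgz]] := trace3_common_zero (a ^+ g).
have [s zs] := alpha_expr_surj z0.
exists (g + inZp s); last first.
  by exists (inZp s); rewrite ?addrK // mem_singer_set -zs Tz.
have -> : g + inZp s = inZp (g + s) by apply: val_inj; rewrite /= modnDmr.
by rewrite mem_singer_set exprD -zs Tgz.
Qed.

Lemma singer_frameE (R : realType) : singer_frame R q a = harmonic_frame R D.
Proof.
apply/matrixP => j c; rewrite !mxE; cbv zeta.
by rewrite dft_entry card_singer_set.
Qed.

End Singer.

(** * Robustness of the Singer frame *)

Theorem theorem4 (R : realType) (q : nat) (hq : prime_power q)
    (L : finFieldType) (hL : #|L| = (q ^ 3)%N)
    (alpha : {unit L}) (halpha : generator [set: {unit L}]%g alpha) :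
  let F := singer_frame R q (val alpha) in
  [/\ difference_set (singer_set q (val alpha)) q.+1 1,
      equiangular_tight_frame F
    & forall C p : R, 1 <= C -> 0 <= p <= 1 ->
        (1 - p) * (q ^ 2 + q).+1%:R \is a Num.int ->
        p <= 1 / 2 - C ^+ 2 / (C ^+ 4 + 1) ->
        numerically_erasure_robust F p C].
Proof.
have hD := singer_difference_set hq hL halpha.
rewrite /= (singer_frameE hq hL halpha); split => //.
  exact: harmonic_frame_etf hD _.
move=> C p C1 /andP[p0 p1] _ hp.
split; first exact: harmonic_frame_is_frame hD _.
move=> K cK; have N0 : 0 < (q ^ 2 + q).+1%:R :> R by rewrite ltr0n.
have C4 : 0 < C ^+ 4 + 1 by rewrite ltr_wpDl // exprn_even_ge0.
(* The identity (C^4 + 1) / 2 - C^2 = (C^2 - 1)^2 / 2. *)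
have hpC : p * (C ^+ 4 + 1) <= (C ^+ 2 - 1) ^+ 2 / 2.
  move: hp; rewrite -(ler_pM2r C4) mulrBl divfK ?gt_eqF // => /le_trans; apply.
  by rewrite le_eqVlt; apply/orP; left; apply/eqP; field.
have p2 : 1 / 2 <= 1 - p.
  have : 0 <= C ^+ 2 / (C ^+ 4 + 1) by rewrite divr_ge0 ?sqr_ge0 // ltW.
  by lra.
apply: (harmonic_frame_columns_cond hD) => //.
  by rewrite -(ltr0n R) cK mulr_gt0 //; lra.
rewrite cK mul1r -{1}[_.+1%:R]mul1r -mulrBl !mulrA ler_pM2r //.
have -> : 1 - (1 - p) = p by ring.
rewrite mulrC; apply: le_trans hpC _.
by rewrite ler_wpM2l ?sqr_ge0 //; lra.
Qed.
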